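(* Let $T$ be a densely defined closable linear operator in a complex Hilbert space $H$ such that $\sigma(TT^* )\cup\sigma(T^*T)\neq\mathbb{C}$. Then $T$ is closed.
   Context: Operators are linear and not necessarily bounded, with a domain $D(T)$ a linear subspace of $H$. Products are defined on natural domains: $D(ST)=\{x\in D(T):Tx\in D(S)\}$. $T$ is closed if its graph is closed, and closable if it has a closed extension. For any (not necessarily closed) operator $S$, the resolvent set $\rho(S)$ is the set of $\lambda\in\mathbb{C}$ such that $\lambda I-S:D(S)\to H$ is bijective with $(\lambda I-S)^{-1}\in B(H)$ (bounded and everywhere defined); $\sigma(S)=\mathbb{C}\setminus\rho(S)$. In particular $\sigma(S)=\mathbb{C}$ if $S$ is not closed. *)

(* Defs.v *)
From HB Require Import structures.
From mathcomp Require Import all_boot all_order all_algebra.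
From mathcomp Require Import all_classical all_reals all_analysis.
From mathcomp Require Import complex.

Set Implicit Arguments.
Unset Strict Implicit.
Unset Printing Implicit Defensive.

Import Order.TTheory GRing.Theory Num.Theory.
Import numFieldNormedType.Exports.

Local Open Scope classical_set_scope.
Local Open Scope ring_scope.
Local Open Scope complex_scope.

(* The inner product [dot] is linear in its first argument and conjugate-linear
   in its second one. *)
HB.mixin Record CompleteNormedModule_isHilbert (R : realType) (H : Type)
    of CompleteNormedModule R[i] H := {
  dot : {dot H for @Num.conj R[i]} ;
  dot_norm : forall x : H, `|x| ^+ 2 = dot x x
}.

#[short(type="hilbertType")]
HB.structure Definition Hilbert (R : realType) :=
  {H of CompleteNormedModule R[i] H & CompleteNormedModule_isHilbert R H}.

Section Operators.
Variables (R : realType) (H : hilbertType R).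

(* The values of [app] outside [dom] are irrelevant: every notion below only
   evaluates an operator on its domain. *)
Record operator := Operator {
  dom : set H ;
  app :> H -> H ;
  dom0 : dom 0 ;
  dom_linear : forall (a : R[i]) (x y : H), dom x -> dom y -> dom (a *: x + y) ;
  app_linear : forall (a : R[i]) (x y : H), dom x -> dom y ->
    app (a *: x + y) = a *: app x + app y
}.

Definition densely_defined (T : operator) : Prop := dense (dom T).

Definition graph (T : operator) : set (H * H) :=
  [set p | dom T p.1 /\ p.2 = T p.1].

Definition closed_op (T : operator) : Prop := closed (graph T).

Definition extends (S T : operator) : Prop :=
  dom T `<=` dom S /\ forall x, dom T x -> S x = T x.

Definition closable (T : operator) : Prop :=
  exists2 S : operator, closed_op S & extends S T.

Lemma app0 (T : operator) : T 0 = 0.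
Proof.
have := app_linear 1 (dom0 T) (dom0 T).
by rewrite !scale1r addr0 => /(congr1 (+%R^~ (- T 0))); rewrite /= addrK subrr.
Qed.

Section Product.
Variables S T : operator.

Definition dom_comp : set H := [set x | dom T x /\ dom S (T x)].

Lemma dom_comp0 : dom_comp 0.
Proof. by split; rewrite ?app0; exact: dom0. Qed.

Lemma dom_comp_linear (a : R[i]) (x y : H) :
  dom_comp x -> dom_comp y -> dom_comp (a *: x + y).
Proof.
move=> [Tx Sx] [Ty Sy]; split; first exact: dom_linear.
by rewrite app_linear//; exact: dom_linear.
Qed.

Lemma comp_linear (a : R[i]) (x y : H) : dom_comp x -> dom_comp y ->
  (S \o T) (a *: x + y) = a *: (S \o T) x + (S \o T) y.
Proof. by move=> [Tx Sx] [Ty Sy] /=; rewrite !app_linear. Qed.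

Definition op_comp : operator := Operator dom_comp0 dom_comp_linear comp_linear.

End Product.

Section Adjoint.
Variables (T : operator) (densT : densely_defined T).

Definition adj_spec (y z : H) : Prop := forall x, dom T x -> dot (T x) y = dot x z.

Definition dom_adj : set H := [set y | exists z, adj_spec y z].

Definition adj (y : H) : H := xget 0 [set z | adj_spec y z].

Lemma adjP y : dom_adj y -> adj_spec y (adj y).
Proof. by move=> [z yz]; rewrite /adj; case: xgetP => [_ -> //|/(_ z)]. Qed.

Lemma dense_ortho0 (z : H) : (forall x, dom T x -> dot x z = 0) -> z = 0.
Proof.
move=> Tz; apply/eqP/negP => /negP z0.
have z_gt0 : 0 < `|z| by rewrite normr_gt0.
have [|x [zx Tx]] := densT _ (ball_open z `|z|).
  by exists z; exact: ballxx.
move: zx; rewrite -ball_normE /= -(@ltr_pXn2r _ 2)// ?nnegrE// !dot_norm.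
have xz : dot z x = 0 by rewrite hermC/= Tz// rmorph0 mulr0.
rewrite (dnormB dot)/= xz rmorph0 addr0 subr0.
by rewrite gtrDl => /lt_geF; rewrite (dnorm_ge0 dot).
Qed.

Lemma adj_uniq y z : dom_adj y -> adj_spec y z -> adj y = z.
Proof.
move=> /adjP yy yz; apply/eqP; rewrite -subr_eq0; apply/eqP/dense_ortho0.
by move=> x Tx; rewrite linearBr/= -yy// -yz// subrr.
Qed.

Lemma adj_specP (a : R[i]) (x y u v : H) :
  adj_spec x u -> adj_spec y v -> adj_spec (a *: x + y) (a *: u + v).
Proof. by move=> xu yv w Tw; rewrite !linearPr/= xu// yv. Qed.

Lemma dom_adj0 : dom_adj 0.
Proof. by exists 0 => x _; rewrite !linear0r. Qed.

Lemma dom_adj_linear (a : R[i]) (x y : H) :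
  dom_adj x -> dom_adj y -> dom_adj (a *: x + y).
Proof. by move=> [u xu] [v yv]; exists (a *: u + v); exact: adj_specP. Qed.

Lemma adj_linear (a : R[i]) (x y : H) : dom_adj x -> dom_adj y ->
  adj (a *: x + y) = a *: adj x + adj y.
Proof.
move=> Ax Ay; apply: adj_uniq; first exact: dom_adj_linear.
by apply: adj_specP; exact: adjP.
Qed.

Definition adjoint : operator := Operator dom_adj0 dom_adj_linear adj_linear.

End Adjoint.

(* [B] ranges over the everywhere defined linear maps; together with the
   bijectivity of [l - S] it is its inverse, required to be bounded. *)
Definition resolvent_set (S : operator) : set R[i] :=
  [set l | set_bij (dom S) setT (fun x => l *: x - S x) /\
     exists B : {linear H -> H},
       (forall x, dom S x -> B (l *: x - S x) = x) /\
       (exists M : R, forall y, `|B y| <= M%:C * `|y|)].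

Definition spectrum (S : operator) : set R[i] := ~` resolvent_set S.

End Operators.

(* Main.v *)
(** Call [y] a weak image of [x] when [<y, z> = <x, T^* z>] for all [z] in
    [D(T^* )]; this is a linear relation containing the closure of the graph of
    [T].  Pick [l] in both resolvent sets, let [(x, y)] be in that closure, and
    write [x = l a - T^* T a] and [y = l b - T T^* b].  Then [c = T a - b]
    satisfies [l <c, z> = <T^* c, T^* z>] for all [z] in [D(T^* )], and the
    surjectivity of [l - T T^*] forces [c = 0].  Hence [T^* T a = T^* b] lies in
    [D(T)], and so does [x]; closability then gives [y = T x]. *)
Require Import Defs.
From mathcomp Require Import all_boot all_order all_algebra.
From mathcomp Require Import all_classical all_reals all_analysis.
From mathcomp Require Import complex ring.

Set Implicit Arguments.
Unset Strict Implicit.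
Unset Printing Implicit Defensive.

Import numFieldNormedType.Exports.
Import Order.TTheory GRing.Theory Num.Theory.

Local Open Scope classical_set_scope.
Local Open Scope ring_scope.

(** Expand [0 <= dot w w] for [w = n *: x - s *: z], a multiple of the component of [x] orthogonal
    to [z], and cancel the factor [n > 0]. *)
Lemma dot_CauchySchwarz {R : realType} {H : hilbertType R} (x z : H) :
  `|dot x z| <= `|x| * `|z|.
Proof.
have [->|z0] := eqVneq z 0; first by rewrite linear0r normr0 mulr_ge0.
set s := dot x z; set n := dot z z.
have n_gt0 : 0 < n by rewrite (dnorm_gt0 dot).
have nn : n^* = n by apply: conj_Creal; exact: gtr0_real.
have : 0 <= dot (n *: x - s *: z) (n *: x - s *: z) by exact: (dnorm_ge0 dot).
rewrite (dnormB dot) /= !(dnormZ dot) linearZr_LR linearZl_LR /= -/s -/n.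
have -> : `|n| = n by exact: gtr0_norm.
rewrite !rmorphM /= conjCK nn !normCK -/n.
have -> : n ^+ 2 * dot x x + s * s^* * n - (s^* * (n * s) + s * (n * s^* ))
   = n * (n * dot x x - s * s^* ) by ring.
rewrite (pmulr_rge0 _ n_gt0) subr_ge0 -normCK /n -!dot_norm => le.
by rewrite -(@ler_pXn2r _ 2)// ?nnegrE ?mulr_ge0// exprMn mulrC.
Qed.

Section Closability.
Variables (R : realType) (H : hilbertType R) (T : operator H).
Hypothesis T_dense : densely_defined T.

Let Tadj := adjoint T_dense.

Definition weak_image (x y : H) : Prop :=
  forall z, dom Tadj z -> dot y z = dot x (Tadj z).

Lemma weak_image_app x : dom T x -> weak_image x (T x).
Proof. by move=> Tx z Tz; exact: (adjP Tz). Qed.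

Lemma weak_imageB l a b x y : weak_image a b -> weak_image x y ->
  weak_image (l *: a - x) (l *: b - y).
Proof.
move=> ab xy z Tz.
by rewrite !linearBl /= !linearZl_LR /= ab// xy.
Qed.

(** The identity holds on the graph, and by Cauchy-Schwarz both of its sides are continuous in
    [(x, y)]. *)
Lemma closure_graph_weak_image x y :
  closure (graph T) (x, y) -> weak_image x y.
Proof.
move=> clxy z Tz; apply/eqP; rewrite -subr_eq0 -normr_eq0; apply/eqP.
set d := `|_|; set K := `|z| + `|Tadj z|.
have K0 : 0 <= K by rewrite addr_ge0.
have K1 : 0 < K + 1 by rewrite ltr_wpDl.
apply/eqP/negPn/negP => d0.
have d_gt0 : 0 < d by rewrite lt_neqAle eq_sym d0 normr_ge0.
have e_gt0 : 0 < d / (K + 1) by rewrite divr_gt0.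
(* With this radius the defect [d] is at most [d * K / (K + 1) < d]; the [+ 1] covers [K = 0]. *)
have [] := clxy (ball x (d / (K + 1)) `*` ball y (d / (K + 1))).
  by exists (ball x (d / (K + 1)), ball y (d / (K + 1))) => //;
    split; exact: nbhsx_ballx.
move=> [a b] [[/= Ta ->]] [].
rewrite /= -!ball_normE /= => xa yTa.
have dE : d = `|dot (y - T a) z - dot (x - a) (Tadj z)|.
  rewrite !linearBl /= (weak_image_app Ta Tz) /d; congr `|_|.
  by rewrite opprB addrA subrK.
have : d < d.
  apply: (@le_lt_trans _ _ (d / (K + 1) * K)).
    rewrite [leLHS]dE mulrDr; apply: le_trans (ler_normB _ _) _.
    by apply: lerD; apply: le_trans (dot_CauchySchwarz _ _) _;
      rewrite ler_wpM2r// ltW.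
  by rewrite mulrAC ltr_pdivrMr// ltr_pM2l// ltrDl.
by rewrite ltxx.
Qed.

(** Testing against [c] itself shows that [l] is real unless [c = 0]. Then [c] is orthogonal to the
    range of [l - T T^*], which contains [c]. *)
Lemma weak_eigenvector_eq0 l c :
    set_surj (dom (op_comp T Tadj)) setT (fun x => l *: x - op_comp T Tadj x) ->
    dom Tadj c -> weak_image (Tadj c) (l *: c) -> c = 0.
Proof.
move=> surj Tc cl.
have clc : l * dot c c = dot (Tadj c) (Tadj c) by rewrite -cl// linearZl_LR.
have [//|c0] := eqVneq c 0.
have cc : 0 < dot c c by rewrite (dnorm_gt0 dot).
have l_real : l^* = l.
  apply: conj_Creal.
  have -> : l = dot (Tadj c) (Tadj c) / dot c c by rewrite -clc mulfK// gt_eqF.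
  by rewrite realM ?realV// ger0_real// (dnorm_ge0 dot).
have [z [Tz TTz] czE] := surj c I.
have : dot c (l *: z - T (Tadj z)) = 0.
  rewrite linearBr /= linearZr_LR /= l_real.
  rewrite -[l * _]linearZl_LR /= cl// [dot c (T _)]hermC /= expr0 mul1r.
  by rewrite (weak_image_app TTz Tc) [X in X - _]hermC /= expr0 mul1r subrr.
by rewrite [X in dot c X]czE => /eqP; rewrite (dnorm_eq0 dot) => /eqP.
Qed.

End Closability.

Theorem theorem2p12 (R : realType) (H : hilbertType R) (T : operator H)
    (T_dense : densely_defined T) (T_closable : closable T)
    (spectra_neq : spectrum (op_comp T (adjoint T_dense))
      `|` spectrum (op_comp (adjoint T_dense) T) <> setT) :
  closed_op T.
Proof.
set Tadj := adjoint T_dense in spectra_neq *.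
have [l [[_ _ surj1] _] [[_ _ surj2] _]] :
    exists2 l, resolvent_set (op_comp T Tadj) l & resolvent_set (op_comp Tadj T) l.
  apply: contra_notP spectra_neq => nl; apply/seteqP; split=> // l _.
  by apply/not_andP => -[l1 l2]; apply: nl; exists l.
move=> [x y] clxy.
have [S closedS [domS ST]] := T_closable.
(* The closed extension fixes [y = S x], so only [x] in [dom T] remains to be shown. *)
have [/= Sx yS] : graph S (x, y).
  apply: closedS; apply: closureS clxy => -[a b] [/= Ta /= ->].
  by split; [exact: domS|rewrite /= ST].
have xy : weak_image T_dense x y by exact: closure_graph_weak_image clxy.
have [a [Ta TsTa] /= aE] := surj2 x I.
have [b [Tb TTb] /= bE] := surj1 y I.
suff Tx : dom T x by split => //=; rewrite yS ST.
have cE : T a - b = -1 *: b + T a by rewrite scaleN1r addrC.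
have Tc : dom Tadj (T a - b) by rewrite cE; exact: dom_linear.
(* The pair is [l (a, T a) - (x, y) - (T^* b, T T^* b)], a combination of weak-image pairs; the
   factors [1] fit it to [weak_imageB]. *)
have weak_c : weak_image T_dense (Tadj (T a - b)) (l *: (T a - b)).
  have -> : Tadj (T a - b) = 1 *: (l *: a - x) - Tadj b.
    by rewrite cE app_linear// -aE subKr scaleN1r scale1r addrC.
  have -> : l *: (T a - b) = 1 *: (l *: T a - y) - T (Tadj b).
    by rewrite -bE scale1r scalerBr opprB (addrC (T _)) addrA addrK.
  apply (weak_imageB 1); last exact (weak_image_app TTb).
  exact (weak_imageB l (weak_image_app Ta) xy).
have /subr0_eq ab := weak_eigenvector_eq0 surj1 Tc weak_c.
(* Both [a] and [T^* b] lie in [dom T]; this form suits [dom_linear]. *)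
have -> : x = l *: a + (-1 *: Tadj b + 0) by rewrite -aE ab addr0 scaleN1r.
apply: dom_linear => //; apply: dom_linear => //; exact: dom0.
Qed.
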